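(* Let $P$ be a double histogram with $n$ vertices. There is a routing scheme for the visibility graph $G(P)$ with maximum routing table size, maximum label size and maximum header size all $O(\log n)$ bits, such that we can route between any two vertices with stretch at most $2$, i.e. $d_\rho(s,t)\le 2\,d(s,t)$ for any two distinct vertices $s,t$ of $P$. Here the routing schemes, taken over all double histograms $P$, form a family of correct routing schemes whose routing functions all use the same algorithm (independent of $P$), and the constant in $O(\log n)$ is absolute.
   Context: **Routing schemes.** Let $G=(V,E)$ be an undirected, unweighted, simple, connected graph. The closed neighborhood $N(v)$ of $v\in V$ is the set consisting of $v$ and all vertices adjacent to $v$. The distance $d(v,w)$ is the minimum number of edges on a path between $v$ and $w$. A routing scheme for $G$ consists of: a label $\mathrm{lab}(v)\in\{0,1\}^+$ for each node $v$, identifying it in the network; a routing table $\rho(v)\in\{0,1\}^*$ for each node $v$; and a routing function $f\colon(\{0,1\}^* )^4\to V\times\{0,1\}^*$. The routing function takes as its four inputs the link table of the current node $s$ (the list $\mathrm{lab}(N(s))$ of the labels of all nodes in $N(s)$), the routing table $\rho(s)$ of the current node, the label $\mathrm{lab}(t)$ of the target node, and the current header $h\in\{0,1\}^*$; it outputs a next node adjacent to $s$ (identified by its label) and a new header. The scheme is correct if for any $s,t\in V$ the sequence $(p_0,h_0)=(s,\varepsilon)$ ($\varepsilon$ the empty string), $(p_{i+1},h_{i+1})=f(\mathrm{lab}(N(p_i)),\rho(p_i),\mathrm{lab}(t),h_i)$ for $i\ge 0$, satisfies: there is $k=k(s,t)\ge 0$ with $p_k=t$ and $p_i\neq t$ for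 $i<k$. Then $\langle p_0,\dots,p_k\rangle$ is the routing path from $s$ to $t$, and $d_\rho(s,t)=k$ is the routing distance. A family of correct routing schemes for a graph class $\mathcal G$ contains a correct routing scheme for every graph in $\mathcal G$, such that all routing functions use the same algorithm: the graph-dependent information is contained only in labels, routing tables and headers. The maximum label size $\mathrm{Lab}(n)$, maximum routing table size $\mathrm{Tab}(n)$ and maximum header size $H(n)$ are the maximum bit lengths of labels, routing tables and headers $h_i$ ($0\le i\le k(s,t)$, $s\ne t$), respectively, over all graphs in $\mathcal G$ with $n$ vertices. The stretch is the maximum of $d_\rho(s,t)/d(s,t)$ over all graphs in $\mathcal G$ with $n$ vertices and all $s\neq t$. **Polygons.** All polygons are simple orthogonal (axis-aligned) polygons, regarded as closed regions of the plane, in general position: no three vertices lie on the same vertical or horizontal line. A double histogram is an $x$-monotone orthogonal polygon $P$ that has a base line, i.e. a horizontal line segment whose relative interior lies in the interior of $P$ and whose left and right endpoints lie on the left and right boundary edge (the leftmost and rightmost vertical edge) of $P$, respectively. Two points $p,q\in P$ are co-visible ($r$-visibility) if and only if the axis-aligned rectangle spanned by $p$ and $q$ is contained in $P$. The visibility graph $G(P)$ has the vertices of $P$ as nodes, and two distinct vertices are adjacent if and only if they are co-visible; all edges are unweighted. *)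

(* Defs.v *)
From mathcomp Require Import all_boot all_order all_algebra.
From mathcomp Require Export finmap.
From mathcomp Require Import all_classical all_reals all_analysis.
Set Implicit Arguments.
Unset Strict Implicit.
Unset Printing Implicit Defensive.
Import Order.TTheory GRing.Theory Num.Theory.
Import numFieldNormedType.Exports.
Local Open Scope classical_set_scope.
Local Open Scope ring_scope.

(* The least [k] such that a walk with [k] edges leads from [s] to [t].
   Shortest walks have fewer than [#|V|] edges; the value is [#|V|] when [t]
   is not reachable from [s]. *)
Definition gdist (V : finType) (e : rel V) (s t : V) : nat :=
  find (fun k => [exists p : k.-tuple V, path e s p && (last s p == t)])
       (iota 0 #|V|).

(* [f links table target header] is the label of the next node together with
   the new header.  The list of labels of the closed neighbourhood is passed as
   a finite set, so that neither its order nor its multiplicities can carry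
   information. *)
Definition routing_function : Type :=
  {fset bitseq} -> bitseq -> bitseq -> bitseq -> bitseq * bitseq.

Definition link_table (V : finType) (e : rel V) (lab : V -> bitseq) (s : V) :
    {fset bitseq} :=
  [fset lab w | w in [pred w | (w == s) || e s w]]%fset.

(* The sequence [(p i, h i)], [i <= k], is the run of the scheme from [s] to
   [t]; the values of [p] and [h] beyond [k] are irrelevant.  [k] is then the
   routing distance, and [k], [p 0 .. p k], [h 0 .. h k] are determined by [s]
   and [t] when [lab] is injective. *)
Record routing_path (f : routing_function) (V : finType) (e : rel V)
    (lab tab : V -> bitseq) (s t : V) (k : nat)
    (p : nat -> V) (h : nat -> bitseq) : Prop := RoutingPath {
  routing_path_start : p 0%N = s /\ h 0%N = [::];
  routing_path_step : forall i, (i < k)%N ->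
    e (p i) (p i.+1) /\
    f (link_table e lab (p i)) (tab (p i)) (lab t) (h i) =
      (lab (p i.+1), h i.+1);
  routing_path_before : forall i, (i < k)%N -> p i <> t;
  routing_path_end : p k = t }.

Record correct_routing_scheme (f : routing_function) (V : finType) (e : rel V)
    (lab tab : V -> bitseq) : Prop := CorrectRoutingScheme {
  routing_label_inj : injective lab;
  routing_label_nonempty : forall v, lab v <> [::];
  routing_reaches : forall s t : V, exists k p h,
    routing_path f e lab tab s t k p h }.

Definition spanned_rect (R : realType) (p q : R * R) : set (R * R) :=
  [set z | Num.min p.1 q.1 <= z.1 <= Num.max p.1 q.1 /\
           Num.min p.2 q.2 <= z.2 <= Num.max p.2 q.2].

(* The edge from [v i] to its cyclic successor.  Edges of orthogonal polygons
   are axis-aligned, so the segment is the (degenerate) rectangle spanned by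
   its endpoints. *)
Definition polygon_edge (R : realType) (n : nat) (v : 'I_n -> R * R)
    (i : 'I_n) : set (R * R) :=
  spanned_rect (v i) (v (ordS i)).

(* [P] is the closed region bounded by the simple closed orthogonal curve with
   vertices [v 0, .., v n.-1] in cyclic order.  The last three fields say that
   [P] is a compact regular closed set whose frontier is that curve; by the
   Jordan curve theorem there is exactly one such [P]. *)
Record orthogonal_polygon (R : realType) (n : nat) (v : 'I_n -> R * R)
    (P : set (R * R)) : Prop := OrthogonalPolygon {
  polygon_size : (2 < n)%N;
  polygon_vertex_inj : injective v;
  polygon_orthogonal : forall i,
    (v i).1 = (v (ordS i)).1 \/ (v i).2 = (v (ordS i)).2;
  polygon_simple : forall i j z, i <> j ->
    polygon_edge v i z -> polygon_edge v j z ->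
    (j = ordS i /\ z = v j) \/ (i = ordS j /\ z = v i);
  polygon_compact : compact P;
  polygon_regular : closure P° = P;
  polygon_frontier : closure P `\` P° = \bigcup_i polygon_edge v i }.

Definition general_position (R : realType) (n : nat) (v : 'I_n -> R * R) :
    Prop :=
  forall i j k, i <> j -> j <> k -> i <> k ->
    ~ ((v i).1 = (v j).1 /\ (v j).1 = (v k).1) /\
    ~ ((v i).2 = (v j).2 /\ (v j).2 = (v k).2).

Definition x_monotone (R : realType) (P : set (R * R)) : Prop :=
  forall x : R, connected [set y | P (x, y)].

Definition leftmost_vertical_edge (R : realType) (n : nat)
    (v : 'I_n -> R * R) (i : 'I_n) : Prop :=
  (v i).1 = (v (ordS i)).1 /\ forall j, (v i).1 <= (v j).1.

Definition rightmost_vertical_edge (R : realType) (n : nat)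
    (v : 'I_n -> R * R) (i : 'I_n) : Prop :=
  (v i).1 = (v (ordS i)).1 /\ forall j, (v j).1 <= (v i).1.

Definition has_base_line (R : realType) (n : nat) (v : 'I_n -> R * R)
    (P : set (R * R)) : Prop :=
  exists xl xr y : R,
    [/\ xl < xr,
        exists2 i, leftmost_vertical_edge v i & polygon_edge v i (xl, y),
        exists2 j, rightmost_vertical_edge v j & polygon_edge v j (xr, y) &
        forall x, xl < x < xr -> P° (x, y)].

Record double_histogram (R : realType) (n : nat) (v : 'I_n -> R * R)
    (P : set (R * R)) : Prop := DoubleHistogram {
  double_histogram_polygon : orthogonal_polygon v P;
  double_histogram_general_position : general_position v;
  double_histogram_x_monotone : x_monotone P;
  double_histogram_base_line : has_base_line v P }.

Definition covisible (R : realType) (P : set (R * R)) (p q : R * R) : Prop :=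
  spanned_rect p q `<=` P.

Definition visibility_graph (R : realType) (n : nat) (v : 'I_n -> R * R)
    (P : set (R * R)) : rel 'I_n :=
  fun i j => (i != j) && `[< covisible P (v i) (v j) >].

(* Main.v *)
(* Let [I v] be the set of vertices whose abscissa is reached horizontally from
   [v] inside [P]; two vertices are co-visible iff each lies in the interval of
   the other.  On each side of the base line these intervals form a laminar
   family, growing towards the base line.  Let the parent of [v] be the vertex
   closest to the base line among those of [I v] on the opposite side.  The
   interval of the parent contains [I v], and two steps to the parent cover all
   that is reached by one edge: this is where the stretch 2 comes from.  Parents
   form a tree, and preorder numbers in the labels tell ancestors of the target.
   A packet climbs to the parent until it sees an ancestor of the target [t] on
   the side (left or right) of [t]; from then on it always moves to the deepest
   ancestor of [t] in sight.  No header is needed, and tables equal labels. *)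
Require Import Defs.
From mathcomp Require Import all_boot all_order all_algebra.
From mathcomp Require Import zify.
Set Implicit Arguments.
Unset Strict Implicit.
Unset Printing Implicit Defensive.
Import Order.TTheory GRing.Theory Num.Theory.

(** * Fixed-width binary encoding of quadruples *)

Fixpoint bits (w a : nat) : bitseq :=
  if w is w'.+1 then odd a :: bits w' a./2 else [::].

Fixpoint bits_val (b : bitseq) : nat :=
  if b is c :: b' then c + (bits_val b').*2 else 0.

Lemma size_bits w a : size (bits w a) = w.
Proof. by elim: w a => //= w IHw a; rewrite IHw. Qed.

Lemma bitsK w a : a < 2 ^ w -> bits_val (bits w a) = a.
Proof.
elim: w a => [|w IHw] a; first by rewrite expn0 ltnS leqn0 => /eqP.
by rewrite expnS /= => a_lt; rewrite IHw ?odd_double_half //; lia.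
Qed.

Definition encode4 (w : nat) (r : nat * nat * nat * nat) : bitseq :=
  let: (a, b, c, d) := r in bits w a ++ bits w b ++ bits w c ++ bits w d.

(** The field width is read off from the length of the string, so decoding is the same algorithm for
    every graph. *)
Definition decode4 (s : bitseq) : nat * nat * nat * nat :=
  let w := size s %/ 4 in
  (bits_val (take w s), bits_val (take w (drop w s)),
   bits_val (take w (drop w (drop w s))), bits_val (drop w (drop w (drop w s)))).

Lemma size_encode4 w r : size (encode4 w r) = 4 * w.
Proof. by case: r => [[[a b] c] d]; rewrite !size_cat !size_bits; lia. Qed.

Lemma encode4K w a b c d : a < 2 ^ w -> b < 2 ^ w -> c < 2 ^ w -> d < 2 ^ w ->
  decode4 (encode4 w (a, b, c, d)) = (a, b, c, d).
Proof.
move=> a_lt b_lt c_lt d_lt; rewrite /decode4 size_encode4 mulKn //=.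
by rewrite !(take_size_cat, drop_size_cat) ?size_bits // !bitsK.
Qed.

(** * Preorder numberings of rooted trees *)

(** Relative to a set [S], so that a numbering can grow vertex by vertex; [last w] ends the block of
    numbers taken by the descendants of [w]. *)
Definition preorder_numbering (V : finType) (p : V -> V) (S : {set V})
    (pre last : V -> nat) : Prop :=
  [/\ {in S &, injective pre},
      {in S, forall v, pre v < #|S| /\ last v < #|S|} &
      {in S &, forall v w, fconnect p v w = (pre w <= pre v <= last w)}].

Lemma fconnectE (V : finType) (p : V -> V) (v w : V) :
  fconnect p v w = (v == w) || fconnect p (p v) w.
Proof.
apply/idP/idP => [/iter_findex <-|/predU1P[->|]]; last 2 first.
- exact: connect0.
- exact: connect_trans (fconnect1 _ _).
case: (findex p v w) => [|k]; first by rewrite /= eqxx.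
by rewrite iterSr fconnect_iter orbT.
Qed.

(** The new leaf [v] is inserted just after its parent [u]: numbers beyond [pre u] move up by one,
    and so does the end of every block that ends at [pre u] or later. *)
Lemma preorder_numbering_add (V : finType) (p : V -> V) (S : {set V})
    (pre last : V -> nat) (v : V) :
  {in S, forall w, p w \in S} -> v \notin S -> p v \in S ->
  preorder_numbering p S pre last ->
  exists pre' last', preorder_numbering p (v |: S) pre' last'.
Proof.
move=> S_p v_S; set u := p v => uS [pre_inj bound ancE].
exists (fun w => if w == v then (pre u).+1 else pre w + (pre u < pre w)).
exists (fun w => if w == v then (pre u).+1 else last w + (pre u <= last w)).
have neq_v w : w \in S -> (w == v) = false.
  by move=> wS; apply: contraNF v_S => /eqP <-.
have anc_v w : w \in S -> fconnect p w v = false.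
  move=> wS; apply: contraNF v_S => /iter_findex <-.
  by elim: (findex _ _ _) => //= k; exact: S_p.
have card : #|v |: S| = #|S|.+1 by rewrite cardsU1 v_S.
split.
- move=> a b /setU1P[->|aS] /setU1P[->|bS]; rewrite ?eqxx ?neq_v //; try lia.
  by move=> ab; apply: pre_inj => //; lia.
- move=> a /setU1P[->|aS]; rewrite card ?eqxx ?neq_v //.
    by have := bound u uS; lia.
  by have := bound a aS; lia.
- move=> a b /setU1P[->|aS] /setU1P[->|bS]; rewrite ?eqxx ?neq_v //.
  + by rewrite connect0 !leqnn.
  + rewrite fconnectE eq_sym neq_v //= ancE // -/u.
    by have := ancE b b bS bS; rewrite connect0; lia.
  + by rewrite anc_v //; have := bound a aS; lia.
  + rewrite ancE //; lia.
Qed.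

Lemma preorder_exists (V : finType) (p : V -> V) (r : V) :
  p r = r -> (forall v, exists k, iter k p v = r) ->
  exists pre last : V -> nat,
  [/\ injective pre, forall v, pre v < #|V| /\ last v < #|V| &
      forall v w, fconnect p v w = (pre w <= pre v <= last w)].
Proof.
move=> p_r to_r.
suff main k : k < #|V| -> exists S : {set V}, [/\ #|S| = k.+1, r \in S,
    {in S, forall w, p w \in S} & exists pre last, preorder_numbering p S pre last].
  have V_gt0 : #|V|.-1 < #|V| by rewrite prednK //; apply/card_gt0P; exists r.
  have [S [cardS _ _ [pre [last [pre_inj bound ancE]]]]] := main _ V_gt0.
  have ST : S = setT.
    by apply/eqP; rewrite eqEcard subsetT cardsT cardS; lia.
  exists pre, last; rewrite ST cardsT in pre_inj bound ancE.
  split=> [v w|v|v w]; [exact: pre_inj|exact: bound|exact: ancE].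
elim: k => [|k IHk] k_lt.
  exists [set r]; split; rewrite ?cards1 ?set11 //.
    by move=> w /set1P ->; rewrite p_r set11.
  exists (fun=> 0), (fun=> 0); split=> [v w /set1P -> /set1P -> //|v _|v w].
    by rewrite cards1.
  by move=> /set1P -> /set1P ->; rewrite connect0.
have [S [cardS rS S_p [pre [last num]]]] := IHk (ltnW k_lt).
have /subsetPn[v0 _ v0S] : ~~ (setT \subset S).
  by apply: contraL k_lt => /subset_leq_card; rewrite cardsT cardS -leqNgt.
(* The new leaf is the last vertex before the path from [v0] to the root enters [S]. *)
have ex : exists i, iter i p v0 \in S by have [i Ei] := to_r v0; exists i; rewrite Ei.
have [v vS pS] : exists2 v, v \notin S & p v \in S.
  case: (ex_minnP ex) => [[|i]]; first by rewrite (negPf v0S).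
  move=> iS i_min; exists (iter i p v0) => //.
  by apply/negP => /i_min; rewrite ltnn.
exists (v |: S); split; first by rewrite cardsU1 vS cardS.
- by rewrite inE rS orbT.
- by move=> w /setU1P[->|/S_p wS]; rewrite !inE ?pS ?wS orbT.
- exact: preorder_numbering_add num.
Qed.

(** * Shortest walks and the routing function *)

Local Open Scope ring_scope.

(** A duplicate-free path has fewer than [#|V|] edges, so the search in [gdist] succeeds and its
    default value does not occur. *)
Lemma gdist_path (V : finType) (e : rel V) (s t : V) : connect e s t ->
  exists p, [/\ path e s p, last s p = t & size p = gdist e s t].
Proof.
case/connectP => p0 path_p0 ->; case/shortenP: path_p0 => p path_p uniq_p _.
set t' := last s p.
pose walk k := [exists q : k.-tuple V, path e s q && (last s q == t')].
have size_p : (size p < #|V|)%N.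
  by have <- : #|s :: p| = (size p).+1 by [apply/card_uniqP]; exact: max_card.
have : has walk (iota 0 #|V|).
  apply/hasP; exists (size p); first by rewrite mem_iota.
  by apply/existsP; exists (in_tuple p); rewrite path_p eqxx.
move=> /[dup] has_walk /(nth_find 0%N); rewrite has_find size_iota in has_walk.
rewrite nth_iota // add0n => /existsP[q /andP[path_q /eqP last_q]].
by exists q; split=> //; rewrite size_tuple.
Qed.

(* A label encodes the preorder number of the vertex, the largest preorder number
   in its subtree, the preorder number of its parent and the rank of its
   abscissa. *)
Definition candidate_label (c t w : bitseq) : bool :=
  let: (cp, cl, _, cx) := decode4 c in
  let: (tp, _, _, tx) := decode4 t in
  let: (wp, wl, _, wx) := decode4 w in
  [&& w != c, wp <= tp <= wl &
      (cp <= tp <= cl) || (if cx <= tx then cx <= wx else wx <= cx)]%N.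

(** Candidates are ancestors of the target, hence form a chain, and the largest preorder number
    marks the deepest. On the labels used below, [best] and [ups] hold at most one label each, so
    taking the head involves no choice. *)
Definition route : routing_function := fun links c t _ =>
  let pre l := (decode4 l).1.1.1 in
  let candidates := [seq w <- links | candidate_label c t w] in
  let best := [seq w <- candidates | all (fun w' => pre w' <= pre w)%N candidates] in
  let ups := [seq w <- links | pre w == (decode4 c).1.2] in
  (if best is w :: _ then w else head [::] ups, [::]).

(** * Routing in interval systems *)

Lemma neqb_eq (a b c : bool) : a != b -> c != b -> a = c.
Proof. by case: a b c => [] [] []. Qed.

Section IntervalSystem.
Variables (R : realDomainType) (V : finType) (x h : V -> R) (up : V -> bool).
Variable I : V -> {set V}.

Definition between (a b c : V) : bool :=
  Num.min (x a) (x b) <= x c <= Num.max (x a) (x b).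

(** What is kept of the geometry: [x] is the abscissa, [h] the distance to the base line, [up] the
    side of it. [I_exit] provides the vertex that blocks the view from [v]. *)
Hypothesis I_refl : forall v, v \in I v.
Hypothesis I_convex : forall v a b c,
  a \in I v -> b \in I v -> between a b c -> c \in I v.
Hypothesis I_nested : forall u w a, up u = up w -> h u <= h w ->
  a \in I u -> a \in I w -> I w \subset I u.
Hypothesis I_exit : forall v a b, a \in I v -> b \notin I v ->
  exists w, [/\ up w = up v, h w < h v, w \in I v & between a b w].

(** * The tree of parents *)

Variable v0 : V.

Definition root : V := [arg min_(w < v0 | up w == up v0) h w]%O.

(** A blocked view would yield a vertex on the same side still closer to the base line. *)
Lemma I_root : I root = setT.
Proof.
rewrite /root; case: arg_minP => [|r /eqP r_v0 r_min]; first exact: eqxx.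
apply/eqP; rewrite -subTset; apply/subsetP => b _; apply/negP => /negP b_r.
have [w [w_r w_lt _ _]] := I_exit (I_refl r) b_r.
by have := r_min w; rewrite w_r r_v0 eqxx leNgt w_lt => /(_ isT).
Qed.

(** Two fallbacks: a vertex with full interval is attached to the root, which is thus its own
    parent; if [I v] stays on the side of [v], its vertex closest to the base line is taken. *)
Definition parent (v : V) : V :=
  if I v == setT then root else
  if [pick w in I v | up w != up v] is Some w
  then [arg min_(u < w | (u \in I v) && (up u != up v)) h u]%O
  else [arg min_(u < v | u \in I v) h u]%O.

Lemma parent_full v : I v = setT -> parent v = root.
Proof. by rewrite /parent => ->; rewrite eqxx. Qed.

Lemma parent_root : parent root = root.
Proof. exact/parent_full/I_root. Qed.

Lemma parentP v : I v != setT ->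
  [/\ parent v \in I v,
      forall w, w \in I v -> up w = up (parent v) -> h (parent v) <= h w &
      up (parent v) = up v -> forall w, w \in I v -> up w = up v].
Proof.
rewrite /parent => /negPf ->.
case: pickP => [w Pw|all_v].
  case: arg_minP => // u /andP[uI u_v] u_min; split=> // [w' wI w_u|u_v'].
    by apply: u_min; rewrite wI w_u.
  by rewrite u_v' eqxx in u_v.
have all_v' w : w \in I v -> up w = up v.
  by move=> wI; have := all_v w; rewrite wI /= => /negbFE /eqP.
by case: arg_minP => // u uI u_min; split=> // w wI _; exact: u_min.
Qed.

Lemma parent_in v : parent v \in I v.
Proof.
have [Iv|/parentP[]//] := eqVneq (I v) setT.
by rewrite parent_full // Iv.
Qed.

(** If the parent's view ended inside [I v], the blocking vertex would be in [I v] by convexity, on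
    the parent's side and closer to the base line, against the choice of the parent. *)
Lemma I_parent v : I v \subset I (parent v).
Proof.
have [Iv|/parentP[pI p_min _]] := eqVneq (I v) setT.
  by rewrite parent_full // I_root subsetT.
apply/subsetP => b bI; apply/negP => /negP b_p.
have [w [w_p w_lt wI w_btw]] := I_exit (I_refl (parent v)) b_p.
have := p_min w (I_convex pI bI w_btw) w_p.
by rewrite leNgt w_lt.
Qed.

Lemma parent_neq v : v != root -> parent v != v.
Proof.
move=> v_r; have [Iv|Iv] := eqVneq (I v) setT.
  by rewrite parent_full // eq_sym.
have [pI p_min _] := parentP Iv.
have /subsetPn[b _ b_v] : ~~ (setT \subset I v) by rewrite subTset.
have [w [w_v w_lt wI _]] := I_exit (I_refl v) b_v.
apply/eqP => p_v; have := p_min w wI; rewrite p_v => /(_ w_v).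
by rewrite leNgt w_lt.
Qed.

(* One of the two steps reaches the vertex of [I u] that is closest to the base
   line on the side of [v], or one that is still closer. *)
Lemma I_sub_grandparent u v : v \in I u -> I v \subset I (parent (parent u)).
Proof.
move=> vu; have [Iu|Iu] := eqVneq (I u) setT.
  by rewrite (parent_full Iu) parent_root I_root subsetT.
have [pI p_min p_same] := parentP Iu.
have vp : v \in I (parent u) := subsetP (I_parent u) v vu.
have [v_p|v_p] := eqVneq (up v) (up (parent u)).
  apply: subset_trans (I_parent _).
  exact: I_nested (esym v_p) (p_min v vu v_p) vp (I_refl v).
have [Ip|Ip] := eqVneq (I (parent u)) setT.
  by rewrite (parent_full Ip) I_root subsetT.
have [ppI pp_min pp_same] := parentP Ip.
have v_pp : up v = up (parent (parent u)).
  have [pp|] := eqVneq (up (parent (parent u))) (up (parent u)).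
    by have := pp_same pp v vp => /eqP; rewrite (negPf v_p).
  exact: neqb_eq.
apply: (I_nested (esym v_pp) (pp_min v vp v_pp) _ (I_refl v)).
exact: subsetP (I_parent _) v vp.
Qed.

(** On the same side, laminarity decides. On opposite sides, the vertex [r] blocking [w] inside
    [I u] lies on the side of [w], so the parent of [u] is on that side too and at most as far from
    the base line as [r]. *)
Lemma I_cross u w a : a \in I u -> a \in I w -> ~~ (I u \subset I w) ->
  I w \subset I (parent u).
Proof.
move=> au aw /subsetPn[b bu bw].
have [Iu|Iu] := eqVneq (I u) setT; first by rewrite parent_full // I_root subsetT.
have [same|opp] := eqVneq (up u) (up w).
  apply: subset_trans (I_parent u).
  case: (leP (h u) (h w)) => [le|/ltW le]; first exact: I_nested same le au aw.
  have /subsetP/(_ b bu) := I_nested (esym same) le aw au.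
  by rewrite (negPf bw).
have [r [r_w r_lt rw r_btw]] := I_exit aw bw.
have ru := I_convex au bu r_btw.
have [pI p_min p_same] := parentP Iu.
have p_w : up (parent u) = up w.
  have [p_u|] := eqVneq (up (parent u)) (up u).
    by have := p_same p_u r ru; rewrite r_w => wu; rewrite wu eqxx in opp.
  by move=> p_u; apply: (neqb_eq p_u); rewrite eq_sym.
have le : h (parent u) <= h w.
  by apply: le_trans (ltW r_lt); apply: p_min; rewrite // r_w p_w.
exact: I_nested p_w le (subsetP (I_parent u) r ru) rw.
Qed.

(** A single step may increase the height, since it can change sides. But within two steps the root
    or a vertex no higher than the one blocking [v] is reached, so the number of lower vertices
    drops. *)
Lemma parent_iter_root v : exists k, iter k parent v = root.
Proof.
have [n] := ubnP #|[set w | h w < h v]|.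
elim: n v => // n IHn v; rewrite ltnS => le_n.
have [Iv|Iv] := eqVneq (I v) setT; first by exists 1%N; rewrite /= parent_full.
have /subsetPn[b _ b_v] : ~~ (setT \subset I v) by rewrite subTset.
have [w [w_v w_lt wI _]] := I_exit (I_refl v) b_v.
have step u : h u <= h w -> exists k, iter k parent u = root.
  move=> le; apply: IHn; apply: leq_trans le_n; apply: proper_card.
  apply/properP; split; last by exists w; rewrite !inE ?w_lt // -leNgt.
  by apply/subsetP => z; rewrite !inE => /lt_le_trans; apply; exact/ltW/(le_lt_trans le).
have [pI p_min p_same] := parentP Iv.
have wp : w \in I (parent v) := subsetP (I_parent v) w wI.
have [p_v|p_v] := eqVneq (up (parent v)) (up v).
  have [k pk] := step _ (p_min w wI (etrans w_v (esym p_v))).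
  by exists k.+1; rewrite iterSr.
have [Ip|Ip] := eqVneq (I (parent v)) setT; first by exists 2%N; rewrite /= (parent_full Ip).
have [ppI pp_min pp_same] := parentP Ip.
have pp_v : up (parent (parent v)) = up w.
  have [pp|] := eqVneq (up (parent (parent v))) (up (parent v)).
    by have := pp_same pp w wp; rewrite w_v => vp; rewrite vp eqxx in p_v.
  by move=> pp; apply: (neqb_eq pp); rewrite w_v eq_sym.
have [k pk] := step _ (pp_min w wp (esym pp_v)).
by exists k.+2; rewrite !iterSr.
Qed.

Definition visible : rel V := fun u w => [&& u != w, w \in I u & u \in I w].

Lemma visible_parent v : v != root -> visible v (parent v).
Proof.
move=> v_r; rewrite /visible eq_sym parent_neq // parent_in.
exact: subsetP (I_parent v) v (I_refl v).
Qed.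

Lemma I_iter_parent i j v : (i <= j)%N ->
  I (iter i parent v) \subset I (iter j parent v).
Proof.
move=> /subnK <-; elim: (j - i)%N => //= k IHk.
exact: subset_trans IHk (I_parent _).
Qed.

(** * The run towards a fixed target *)

Variable pre : V -> nat.
Hypothesis pre_inj : injective pre.
Hypothesis pre_anc : forall v w, fconnect parent v w -> (pre w <= pre v)%N.

Definition toward (c t w : V) : bool :=
  if x c <= x t then x c <= x w else x w <= x c.

(** The side condition is dropped once [c] is itself an ancestor of [t]: from there every visible
    ancestor of [t] is acceptable. *)
Definition candidate (c t w : V) : bool :=
  [&& visible c w, fconnect parent t w & fconnect parent t c || toward c t w].

Definition next (t c : V) : V :=
  if [pick w | candidate c t w] is Some w0
  then [arg max_(w > w0 | candidate c t w) pre w] else parent c.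

Lemma next_candidate t c w : candidate c t w ->
  candidate c t (next t c) /\
  forall w', candidate c t w' -> (pre w' <= pre (next t c))%N.
Proof.
rewrite /next => cw; case: pickP => [w0 cw0|/(_ w)]; last by rewrite cw.
by case: arg_maxnP => // w1 cw1 w1_max; split.
Qed.

Lemma next_parent t c : (forall w, ~~ candidate c t w) -> next t c = parent c.
Proof. by rewrite /next => nc; case: pickP => // w; rewrite (negPf (nc w)). Qed.

Section Target.
Variable t : V.

Notation anc j := (iter j parent t).

Definition reaches_in (c : V) (k : nat) : Prop :=
  exists2 m, (m <= k)%N & iter m (next t) c = t.

Lemma reaches_in_le c k l : (k <= l)%N -> reaches_in c k -> reaches_in c l.
Proof. by move=> kl [m mk mt]; exists m => //; exact: leq_trans kl. Qed.

Lemma reaches_in_next c k : reaches_in (next t c) k -> reaches_in c k.+1.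
Proof. by move=> [m mk mt]; exists m.+1; rewrite // iterSr. Qed.

Lemma reaches_in_refl k : reaches_in t k.
Proof. by exists 0%N. Qed.

(** Preorder numbers do not increase along the chain of ancestors, so the maximal one belongs to an
    index at most [j]. *)
Lemma next_deeper c j : candidate c t (anc j) ->
  exists2 i, (i <= j)%N & next t c = anc i.
Proof.
move=> /[dup] /next_candidate[/and3P[_ /iter_findex Ei _] i_max] /i_max le_pre.
rewrite -{}Ei in le_pre *; move: (findex _ _ _) le_pre => i le_pre.
have [ij|/ltnW ji] := leqP i j; first by exists i.
exists j => //; apply/pre_inj/eqP; rewrite eqn_leq le_pre andbT.
by apply: pre_anc; rewrite -(subnK ji) iterD fconnect_iter.
Qed.

Lemma reaches_in_anc q : reaches_in (anc q) q.
Proof.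
have [n] := ubnP q; elim: n q => // n IHn [|q] lt_qn; first exact: reaches_in_refl.
have [r_q|] := eqVneq (anc q) root.
  apply: reaches_in_le (leqnSn q) _; rewrite iterS r_q parent_root -r_q.
  exact: IHn.
move=> /visible_parent/andP[nq /andP[Iq Ip]].
have /next_deeper[i iq Ei] : candidate (anc q.+1) t (anc q).
  by rewrite /candidate /visible iterS eq_sym nq Iq Ip fconnect_iter -iterS fconnect_iter.
apply: reaches_in_next; rewrite Ei; apply: (reaches_in_le iq).
by apply: IHn; rewrite (leq_ltn_trans iq) // (leq_trans _ lt_qn).
Qed.

Lemma reaches_in_adjacent c j : anc j \in I c -> c \in I (anc j) ->
  fconnect parent t c || toward c t (anc j) -> reaches_in c j.+1.
Proof.
move=> jc cj side; have [->|c_j] := eqVneq c (anc j).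
  exact: reaches_in_le (leqnSn j) (reaches_in_anc j).
have /next_deeper[i ij Ei] : candidate c t (anc j).
  by rewrite /candidate /visible c_j jc cj fconnect_iter side.
apply: reaches_in_next; rewrite Ei; exact: reaches_in_le ij (reaches_in_anc i).
Qed.

(* [t] lies on one side of [c] as long as the intervals of its ancestors avoid
   [c]; [anc j] below is the first ancestor whose interval contains [c]. *)
Definition entry_spec (c : V) (j : nat) : Prop :=
  c \in I (anc j) /\ forall i, c \in I (anc i) -> (j <= i)%N.

Lemma entry_exists c i : c \in I (anc i) ->
  exists2 j, (j <= i)%N & entry_spec c j.
Proof.
move=> ci; have ex : exists j, c \in I (anc j) by exists i.
exists (ex_minn ex); first by case: ex_minnP => j _; apply.
by case: ex_minnP => j cj j_min; split.
Qed.

(** The interval before the entry contains [t] and [anc j] but not [c]; by convexity both lie on the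
    same side of [c]. *)
Lemma toward_entry c j : entry_spec c j -> toward c t (anc j).
Proof.
case: j => [|j] [cj j_min]; rewrite /toward; first by case: (leP (x c) (x t)) => // /ltW.
have c_j : c \notin I (anc j) by apply/negP => /j_min; rewrite ltnn.
have tj : t \in I (anc j) := subsetP (I_iter_parent t (leq0n j)) t (I_refl t).
have sj : anc j.+1 \in I (anc j) := parent_in _.
by case: (leP (x c) (x t)) => ct; rewrite leNgt; apply: contra c_j => sc;
   apply: (I_convex tj sj); rewrite /between ge_min le_max ?ct ?(ltW sc) ?(ltW ct) ?orbT.
Qed.

Lemma reaches_in_entry c j : entry_spec c j -> anc j \in I c ->
  reaches_in c j.+1.
Proof.
move=> cj jc; apply: reaches_in_adjacent => //; first by case: cj.
by rewrite toward_entry ?orbT.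
Qed.

(** Suppose [anc j] is not in [I c]. Then the chosen ancestor lies between [c] and [anc j], for
    otherwise convexity would put [anc j] into [I c]. So it sees [anc j], and one more step leads
    there or deeper. *)
Lemma reaches_in_candidate c j w : entry_spec c j -> candidate c t w ->
  reaches_in c j.+2.
Proof.
move=> ce cw; have [cj j_min] := ce.
have [jc|j_c] := boolP (anc j \in I c).
  exact: reaches_in_le (leqnSn _) (reaches_in_entry ce jc).
have [/and3P[/and3P[_ nc cn] /iter_findex En /orP[/iter_findex Ec|side]] _] := next_candidate cw.
  case/negP: j_c; have := j_min (findex parent t c); rewrite Ec => /(_ (I_refl c)) le_j.
  by rewrite -Ec; exact: subsetP (I_iter_parent t le_j) _ (I_refl _).
apply: reaches_in_next; rewrite -En; set q := findex _ _ _ in En *.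
have le_jq : (j <= q)%N by apply: j_min; rewrite En.
apply: reaches_in_adjacent; last by rewrite fconnect_iter.
  exact: subsetP (I_iter_parent t le_jq) _ (I_refl _).
apply: (I_convex cj (I_refl (anc j))); rewrite En /between.
have := toward_entry ce; move: side; rewrite /toward.
rewrite ge_min le_max.
case: (leP (x c) (x t)) => _ cn_x cj_x; rewrite cn_x /= ?orbT ?andbT.
  apply/orP; right; rewrite leNgt; apply: contra j_c => /ltW lt_x.
  by apply: (I_convex (I_refl c) nc); rewrite /between ge_min le_max cj_x lt_x orbT.
apply/orP; right; rewrite leNgt; apply: contra j_c => /ltW lt_x.
by apply: (I_convex (I_refl c) nc); rewrite /between ge_min le_max cj_x lt_x orbT.
Qed.

Lemma reaches_in_climb c j k : entry_spec c j -> (j.+2 <= k.+1)%N ->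
  (anc j \notin I c -> reaches_in (parent c) k) -> reaches_in c k.+1.
Proof.
move=> cj jk climb; have [w cw|nc] := pickP (candidate c t).
  exact: reaches_in_le jk (reaches_in_candidate cj cw).
have [jc|j_c] := boolP (anc j \in I c).
  exact: reaches_in_le (ltnW jk) (reaches_in_entry cj jc).
apply: reaches_in_next; rewrite next_parent => [|w]; last by rewrite nc.
exact: climb.
Qed.

(* Climbing two steps from [u] compensates for the two steps by which the interval
   of the relevant ancestor of [t] shrinks, unless the intervals cross; in that
   case [I_cross] makes the parents mutually visible. *)
Lemma reaches_in_round u m : u \in I (anc m.+2) ->
  (exists2 a, a \in I u & a \in I (anc m)) ->
  (parent (parent u) \in I (anc m) -> reaches_in (parent (parent u)) m.+2) ->
  reaches_in u m.+4.
Proof.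
move=> u_m2 [a au am] IH.
have anc_in i k : (i <= k)%N -> anc i.+1 \in I (anc k).
  by move=> ik; exact: subsetP (I_iter_parent t ik) _ (parent_in _).
have anc_refl i k : (i <= k)%N -> anc i \in I (anc k).
  by move=> ik; exact: subsetP (I_iter_parent t ik) _ (I_refl _).
have sub i k : (i <= k)%N -> {subset I (anc i) <= I (anc k)}.
  by move=> ik; exact/subsetP/I_iter_parent.
have [j j_m2 uj] := entry_exists u_m2.
apply: (reaches_in_climb uj) => // j_u; set u1 := parent u in IH *.
have u1u : u1 \in I u := parent_in u.
(* If [I u] lies inside [I (anc m)], either [u2] does too and [IH] applies, or [I u1] sticks out,
   and crossing lets [u2] and its entry ancestor see each other. *)
have [um|u_m] := boolP (I u \subset I (anc m)).
  have [j1 j1_m u1j] := entry_exists (subsetP um _ u1u).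
  apply: (reaches_in_climb u1j); first by rewrite !ltnS (leq_trans j1_m) ?leqnSn.
  move=> j1_u1; set u2 := parent u1 in IH *.
  have u2u1 : u2 \in I u1 := parent_in u1.
  have [|u2_m] := boolP (u2 \in I (anc m)); first exact: IH.
  have u1_m : ~~ (I u1 \subset I (anc m)) by apply: contra u2_m => /subsetP; apply.
  have m_u2 := subsetP (I_cross (I_refl u1) (subsetP um _ u1u) u1_m).
  have j1_u1' : ~~ (I (anc j1) \subset I u1).
    by apply: contra j1_u1 => /subsetP; apply; exact: I_refl.
  have u1_j1 := I_cross u1j.1 (I_refl u1) j1_u1'.
  have u2_m1 : u2 \in I (anc m.+1) by apply: (sub j1.+1) => //; exact: (subsetP u1_j1).
  have [j2 j2_m1 u2j] := entry_exists u2_m1.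
  apply: (reaches_in_le _ (reaches_in_entry u2j _)) => //.
  by apply: m_u2; move: j2_m1; rewrite leq_eqVlt ltnS => /predU1P[->|/anc_refl//]; exact: anc_in.
(* Otherwise one climb already covers [I (anc m)]; it remains to find an entry ancestor for [u1]
   that [u1] sees. *)
have m_u1 := subsetP (I_cross au am u_m).
have [mu|m_u] := boolP (I (anc m) \subset I u); last first.
  have u_m1 : {subset I u <= I (anc m.+1)} := subsetP (I_cross am au m_u).
  have [j1 j1_m1 u1j] := entry_exists (u_m1 _ u1u).
  apply: (reaches_in_le _ (reaches_in_entry u1j _)).
    by rewrite ltnS (leq_trans j1_m1) ?leqnSn.
  by apply: m_u1; move: j1_m1; rewrite leq_eqVlt ltnS => /predU1P[->|/anc_refl//]; exact: anc_in.
(* Now [I u] contains [I (anc m)]. An entry before [m.+2] would make [anc j] visible from [u]; so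
   the crossing argument is repeated one level up. *)
have j_m : j = m.+2.
  apply/eqP; rewrite eqn_leq j_m2 ltnNge; apply: contra j_u => j_m1.
  apply: (subsetP mu); move: j_m1; rewrite leq_eqVlt ltnS => /predU1P[->|/anc_refl//].
  exact: anc_in.
have m1_u : ~~ (I (anc m.+1) \subset I u).
  by apply: contra j_u => /subsetP; apply; rewrite j_m; exact: anc_in.
have u_m1 : ~~ (I u \subset I (anc m.+1)).
  apply/negP => /subsetP /(_ u (I_refl u)) /uj.2; by rewrite j_m ltnn.
have a_m1 : a \in I (anc m.+1) := sub m m.+1 (leqnSn m) a am.
have m1_u1 := subsetP (I_cross au a_m1 u_m1).
have u_m2' : {subset I u <= I (anc m.+2)} := subsetP (I_cross a_m1 au m1_u).
have [j1 j1_m2 u1j] := entry_exists (u_m2' _ u1u).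
apply: (reaches_in_le _ (reaches_in_entry u1j _)) => //.
by apply: m1_u1; move: j1_m2; rewrite leq_eqVlt ltnS => /predU1P[->|/anc_refl//]; exact: anc_in.
Qed.

(** One use of [I_sub_grandparent] per edge, backwards from [t]. *)
Lemma I_sub_path w p : path visible w p -> last w p = t ->
  I w \subset I (anc (2 * size p)).
Proof.
elim: p w => [|v p IHp] w; first by move=> _ <-.
case/andP=> /and3P[_ _ wv] vis_p /(IHp _ vis_p) v_sub.
rewrite [size _]/= mulnS !addSn add0n; apply: I_sub_grandparent; exact: subsetP v_sub _ wv.
Qed.

(* While [w] moves one edge along a walk to [t], [u] climbs two steps. *)
Lemma reaches_in_cover u w v p : path visible w (v :: p) -> last v p = t ->
  I w \subset I u -> u \in I (anc (2 * size p)) -> reaches_in u (2 * size p).+2.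
Proof.
elim: p u w v => [|v' p IHp] u w v.
  move=> /= /andP[/and3P[_ vw _] _] v_t wu ut; have [j] := entry_exists (i := 0) ut.
  rewrite leqn0 => /eqP -> u0; apply: (reaches_in_le (leqnSn _)).
  by apply: reaches_in_entry; rewrite //= -v_t (subsetP wu).
rewrite [path _ _ _]/= => /andP[/and3P[_ vw _] vis] last_p wu.
have vu := subsetP wu v vw.
rewrite [size _]/= mulnS !addSn add0n => u_m2; apply: reaches_in_round => //.
  exists v => //; case/andP: vis => /and3P[_ _ vv'] vis.
  exact: subsetP (I_sub_path vis last_p) v vv'.
by apply: IHp vis last_p _; exact: I_sub_grandparent.
Qed.

Lemma reaches_in_path s p : path visible s p -> last s p = t ->
  reaches_in s (2 * size p).
Proof.
case: p => [|v p] vis_p last_p; first by rewrite (last_p : s = t); exact: reaches_in_refl.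
rewrite [size _]/= mulnS; apply: (reaches_in_cover vis_p last_p (subxx _)).
case/andP: vis_p => /and3P[_ _ sv] vis_p.
exact: subsetP (I_sub_path vis_p last_p) s sv.
Qed.

End Target.

(** Climbing fails to be an edge only at the root, and there it does not happen: the child of the
    root on the chain to [t] is a candidate. *)
Lemma next_visible t c : c != t -> visible c (next t c).
Proof.
move=> c_t; have [w cw|nc] := pickP (candidate c t).
  by have [/and3P[]] := next_candidate cw.
rewrite next_parent => [|w]; last by rewrite nc.
apply: visible_parent; apply/eqP => cr.
have ct : fconnect parent t c 
  by rewrite cr; have [k <-] := parent_iter_root t; exact: fconnect_iter.
have : exists k, iter k parent t == c by exists (findex parent t c); rewrite iter_findex.
move=> ex; case: (ex_minnP ex) => [[|k]]; first by rewrite /= eq_sym (negPf c_t).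
rewrite iterS => /eqP Ek k_min; have := nc (iter k parent t).
have k_r : iter k parent t != root by rewrite -cr; apply/negP => /k_min; rewrite ltnn.
have := visible_parent k_r; rewrite Ek /candidate ct fconnect_iter !andbT.
by rewrite /visible eq_sym => /and3P[-> -> ->].
Qed.

Lemma visible_sym u w : visible u w = visible w u.
Proof. by rewrite /visible eq_sym [X in _ && X]andbC. Qed.

Lemma visible_connect u w : connect visible u w.
Proof.
have to_root v : connect visible v root.
  have [k <-] := parent_iter_root v; elim: k => [|k IHk]; first exact: connect0.
  apply: connect_trans IHk _; rewrite iterS.
  have [->|/visible_parent] := eqVneq (iter k parent v) root; last exact: connect1.
  by rewrite parent_root connect0.
apply: connect_trans (to_root u) _.
by rewrite (sym_connect_sym visible_sym).
Qed.

(** * Labels, and the run of [route] on them *)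

Variable last : V -> nat.
Hypothesis pre_last : forall v, (pre v < #|V|)%N /\ (last v < #|V|)%N.
Hypothesis ancE : forall v w, fconnect parent v w = (pre w <= pre v <= last w)%N.

(** Replaces the real abscissa in labels: same comparisons, ties included, but bounded by [#|V|]. *)
Definition x_rank (v : V) : nat := #|[set u | x u < x v]|.

Lemma leq_x_rank u v : (x_rank u <= x_rank v)%N = (x u <= x v).
Proof.
apply/idP/idP => [|uv]; last first.
  by apply/subset_leq_card/subsetP => w; rewrite !inE => /lt_le_trans; apply.
apply: contraTT; rewrite -!ltNge -ltnNge => vu; apply/proper_card/properP; split.
  by apply/subsetP => w; rewrite !inE => /lt_trans; apply.
by exists v; rewrite !inE ?ltxx.
Qed.

Lemma x_rank_lt v : (x_rank v < #|V|)%N.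
Proof.
rewrite -cardsT; apply/proper_card/properP; split; first exact: subsetT.
by exists v; rewrite !inE ?ltxx.
Qed.

Definition label (v : V) : bitseq :=
  encode4 (trunc_log 2 #|V|).+1 (pre v, last v, pre (parent v), x_rank v).

Lemma labelK v : decode4 (label v) = (pre v, last v, pre (parent v), x_rank v).
Proof.
have bound a : (a < #|V|)%N -> (a < 2 ^ (trunc_log 2 #|V|).+1)%N.
  by move=> /ltn_trans; apply; exact: trunc_log_ltn.
by rewrite encode4K //; apply: bound; rewrite ?x_rank_lt //; case: (pre_last v);
  case: (pre_last (parent v)).
Qed.

Lemma label_inj : injective label.
Proof. by move=> u v /(congr1 decode4); rewrite !labelK => -[/pre_inj]. Qed.

(** Visibility is not tested on labels: membership in the link table implies it, except for [c]
    itself, which is excluded by its label. *)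
Lemma candidate_labelE c t w : (w == c) || visible c w ->
  candidate_label (label c) (label t) (label w) = candidate c t w.
Proof.
move=> cw; rewrite /candidate_label (inj_eq label_inj) !labelK -!ancE !leq_x_rank.
rewrite /candidate /toward; case/predU1P: cw => [->|/[dup] + ->].
  by rewrite eqxx /visible eqxx.
by rewrite /visible eq_sym => /and3P[->].
Qed.

Lemma mem_link_table c l : l \in link_table visible label c ->
  exists2 w, (w == c) || visible c w & l = label w.
Proof. by case/imfsetP => w /= cw ->; exists w. Qed.

Lemma link_table_mem c w : (w == c) || visible c w -> label w \in link_table visible label c.
Proof. by move=> cw; apply/imfsetP; exists w. Qed.

Lemma routeE c t hd :
  route (link_table visible label c) (label c) (label t) hd = (label (next t c), [::]).
Proof.
rewrite /route; set links := link_table _ _ _; set best := filter _ _.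
have [w cw|nc] := pickP (candidate c t).
  have [c_next next_max] := next_candidate cw.
  have next_link : (next t c == c) || visible c (next t c).
    by case/andP: c_next => ->; rewrite orbT.
  have best_next l : l \in best -> l = label (next t c).
    rewrite !mem_filter => /and3P[/allP max_l cl].
    case/mem_link_table => u cu Eu; rewrite Eu candidate_labelE // in max_l cl *.
    congr label; apply/pre_inj/eqP; rewrite eqn_leq next_max //=.
    have := max_l (label (next t c)); rewrite !labelK; apply.
    by rewrite mem_filter candidate_labelE // c_next; exact: link_table_mem.
  have : label (next t c) \in best.
    rewrite !mem_filter candidate_labelE // c_next [_ \in _]link_table_mem // !andbT.
    apply/allP => l; rewrite mem_filter => /andP[+ /mem_link_table[u cu Eu]].
    by rewrite Eu candidate_labelE // !labelK => /next_max.
  case: best best_next => // l best' best_next _.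
  by rewrite (best_next l) ?mem_head.
rewrite next_parent => [|w]; last by rewrite nc.
have -> : best = [::].
  apply/eqP; rewrite -size_eq0 -leqn0 leqNgt -has_predT; apply/hasPn => l.
  rewrite !mem_filter => /and3P[_ + /mem_link_table[w cw El]].
  by rewrite El candidate_labelE // nc.
set ups := filter _ _; congr pair.
have ups_parent l : l \in ups -> l = label (parent c).
  rewrite mem_filter => /andP[+ /mem_link_table[w _ El]].
  by rewrite El !labelK => /eqP /pre_inj ->.
have : label (parent c) \in ups.
  rewrite mem_filter !labelK eqxx; apply: link_table_mem.
  have [->|/visible_parent ->] := eqVneq c root; last by rewrite orbT.
  by rewrite parent_root eqxx.
case: ups ups_parent => // l ups' ups_parent _.
by rewrite /= (ups_parent l) ?mem_head.
Qed.

Lemma routing_path_iter t s k p hd :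
  routing_path route visible label label s t k p hd ->
  forall i, (i <= k)%N -> p i = iter i (next t) s /\ hd i = [::].
Proof.
move=> [[p0 h0] step before _]; elim=> [|i IHi] ik; first by rewrite p0 h0.
have [_] := step i ik; rewrite routeE => /[dup] /(congr1 fst) /label_inj <-.
move=> /(congr1 snd) /= <-.
by have [-> _] := IHi (ltnW ik).
Qed.

Lemma reaches_in_gdist s t : reaches_in t s (2 * gdist visible s t).
Proof.
have [p [vis_p last_p <-]] := gdist_path (visible_connect s t).
exact: reaches_in_path.
Qed.

Lemma interval_routing_scheme :
  [/\ correct_routing_scheme route visible label label,
      (forall v, size (label v) = 4 * (trunc_log 2 #|V|).+1)%N &
      forall s t k p hd, routing_path route visible label label s t k p hd ->
        (forall i, (i <= k)%N -> hd i = [::]) /\ (k <= 2 * gdist visible s t)%N].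
Proof.
split=> [|v|s t k p hd run]; last 2 first.
- exact: size_encode4.
- have run_iter := routing_path_iter run; split=> [i /run_iter[]//|].
  have [m m_le Em] := reaches_in_gdist s t.
  (* A longer run would have met [t] at time [m], before its end. *)
  rewrite leqNgt; apply/negP => k_gt; have mk := leq_ltn_trans m_le k_gt.
  have [pm _] := run_iter m (ltnW mk).
  by case: run => _ _ /(_ m mk); rewrite pm.
split; [exact: label_inj|by move=> v /(congr1 size); rewrite size_encode4|].
move=> s t; have ex : exists m, iter m (next t) s == t.
  by have [m _ Em] := reaches_in_gdist s t; exists m; rewrite Em.
have [k /eqP Ek k_min] := ex_minnP ex.
have before i : (i < k)%N -> iter i (next t) s <> t.
  by move=> ik /eqP /k_min; rewrite leqNgt ik.
exists k, (fun i => iter i (next t) s), (fun=> [::]); split=> // i ik.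
by split; [apply/next_visible/eqP/before|exact: routeE].
Qed.

End IntervalSystem.

Lemma interval_system_routing (R : realDomainType) (V : finType) (x h : V -> R)
    (up : V -> bool) (I : V -> {set V}) (v0 : V) :
  (forall v, v \in I v) ->
  (forall v a b c, a \in I v -> b \in I v -> between x a b c -> c \in I v) ->
  (forall u w a, up u = up w -> h u <= h w -> a \in I u -> a \in I w ->
    I w \subset I u) ->
  (forall v a b, a \in I v -> b \notin I v ->
    exists w, [/\ up w = up v, h w < h v, w \in I v & between x a b w]) ->
  exists lab : V -> bitseq,
  [/\ correct_routing_scheme route (visible I) lab lab,
      (forall v, size (lab v) = 4 * (trunc_log 2 #|V|).+1)%N &
      forall s t k p hd, routing_path route (visible I) lab lab s t k p hd ->
        (forall i, (i <= k)%N -> hd i = [::]) /\ (k <= 2 * gdist (visible I) s t)%N].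
Proof.
move=> I_refl I_convex I_nested I_exit.
have [pre [last [pre_inj pre_last ancE]]] := preorder_exists
  (parent_root I_refl I_exit v0) (parent_iter_root I_refl I_convex I_exit v0).
exists (label x h up I v0 pre last).
by apply: interval_routing_scheme => // v w; rewrite ancE => /andP[].
Qed.

(** * Visibility in double histograms *)

From mathcomp Require Import all_classical all_reals all_analysis.
From mathcomp Require Import lra.
Import numFieldNormedType.Exports.
Local Open Scope classical_set_scope.

(** The segment with endpoints in either order, in a form without [Num.min] and [Num.max] that suits
    [lra]. *)
Definition seg (R : realDomainType) (a b c : R) : bool :=
  (a <= c <= b) || (b <= c <= a).

Lemma segE (R : realDomainType) (a b c : R) :
  (Num.min a b <= c <= Num.max a b) = seg a b c.
Proof. by rewrite /seg ge_min le_max; apply/idP/idP; lra. Qed.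

(** Used to perturb a coordinate without passing another vertex coordinate. *)
Lemma finite_gap (R : realDomainType) (n : nat) (f : 'I_n -> R) (y : R) :
  exists2 e, 0 < e & forall i, f i != y -> e <= `|f i - y|.
Proof.
have [i0 i0_y|all_y] := pickP [pred i | f i != y].
  case: (@arg_minP _ _ _ i0 (fun i => f i != y) (fun i => `|f i - y|) i0_y).
  move=> i i_y i_min; exists `|f i - y| => //.
  by rewrite normr_gt0 subr_eq0.
by exists 1 => // i; have := all_y i => /= ->.
Qed.

Lemma seg_dist (R : realDomainType) (a b c : R) : seg a b c -> `|c - a| <= `|b - a|.
Proof.
by rewrite /seg => /orP[] /andP[? ?]; [rewrite !ger0_norm|rewrite !ler0_norm]; lra.
Qed.

Lemma pull_back (R : realFieldType) (a b e : R) : a != b -> 0 < e ->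
  exists c, [/\ seg a b c, `|c - a| < `|b - a| & `|c - b| < e].
Proof.
move=> ab e0; case: (ltgtP a b) ab => // ab _.
  exists (b - Num.min e (b - a) / 2).
  have : Num.min e (b - a) <= e by rewrite ge_min lexx.
  have : Num.min e (b - a) <= b - a by rewrite ge_min lexx orbT.
  have : 0 < Num.min e (b - a) by rewrite lt_min e0 subr_gt0.
  move: (Num.min _ _) => d d0 d1 d2; rewrite /seg (gtr0_norm (x := b - a)); last lra.
  by split; rewrite ?ltr_norml; lra.
exists (b + Num.min e (a - b) / 2).
have : Num.min e (a - b) <= e by rewrite ge_min lexx.
have : Num.min e (a - b) <= a - b by rewrite ge_min lexx orbT.
have : 0 < Num.min e (a - b) by rewrite lt_min e0 subr_gt0.
move: (Num.min _ _) => d d0 d1 d2; rewrite /seg (ltr0_norm (x := b - a)); last lra.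
by split; rewrite ?ltr_norml; lra.
Qed.

(** * Topology of the polygon *)

Section DoubleHistogram.
Variables (R : realType) (n : nat) (v : 'I_n -> R * R) (P : set (R * R)).
Hypothesis polyP : orthogonal_polygon v P.
Hypothesis monoP : x_monotone P.

Lemma polygon_closed : closed P.
Proof. exact: compact_closed (@norm_hausdorff _ _) (polygon_compact polyP). Qed.

Lemma edge_sub i z : polygon_edge v i z -> P z /\ ~ P° z.
Proof.
move=> iz; have : (closure P `\` P°) z by rewrite (polygon_frontier polyP); exists i.
by move=> [/(@polygon_closed)].
Qed.

Lemma interior_or_edge z : P z -> P° z \/ exists i, polygon_edge v i z.
Proof.
move=> Pz; have [|nz] := pselect (P° z); [by left|right].
have : (closure P `\` P°) z by split=> //; exact: subset_closure.
by rewrite (polygon_frontier polyP) => -[i _ iz]; exists i.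
Qed.

(** If the segment met no edge, its part in [P] would be both closed and open in it, the points of
    [P] there being interior; the segment is connected. *)
Lemma horizontal_exit x1 x2 y : P (x1, y) -> ~ P (x2, y) ->
  exists i x, seg x1 x2 x /\ polygon_edge v i (x, y).
Proof.
move=> P1 P2; apply: contrapT => no_edge.
have in_int x : seg x1 x2 x -> P (x, y) -> P° (x, y).
  move=> sx /interior_or_edge[//|[i ix]]; case: no_edge.
  by exists i, x.
have cont : continuous (fun x : R => (x, y)).
  move=> x; exact: (@cvg_pair _ _ _ (nbhs x) (nbhs x) (nbhs y) _ _ _ id (fun=> y)
    (@cvg_id _ _) (cvg_cst _)).
set A := [set x | seg x1 x2 x].
have conA : connected A.
  apply/connected_intervalP => a b /= Aa Ab c; move: Aa Ab; rewrite /A /seg /=; lra.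
have A1 : A x1 by rewrite /A /seg /=; lra.
have A2 : A x2 by rewrite /A /seg /=; lra.
have E := conA (A `&` [set x | P (x, y)]).
apply: P2; have : (A `&` [set x | P (x, y)]) x2; last by case.
rewrite E //; first by exists x1.
  exists ((fun x => (x, y)) @^-1` P°).
    by move/continuousP: cont; apply; exact: open_interior.
  apply/seteqP; split=> x [Ax]; split=> //=; first exact: in_int.
  exact: (@interior_subset _ P).
exists ((fun x => (x, y)) @^-1` P) => //.
by move/continuous_closedP: cont; apply; exact: polygon_closed.
Qed.

Lemma vertical_convex x y1 y2 y : P (x, y1) -> P (x, y2) -> seg y1 y2 y -> P (x, y).
Proof.
move=> P1 P2 sy; have /connected_intervalP int : connected [set y | P (x, y)] by exact: monoP.
by case/orP: sy; [exact: (int y1 y2)|exact: (int y2 y1)].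
Qed.

Lemma outside_box z : ~ P z -> exists2 e, 0 < e &
  forall x y, `|x - z.1| < e -> `|y - z.2| < e -> ~ P (x, y).
Proof.
move=> nPz; have : nbhs z (~` P).
  by apply: open_nbhs_nbhs; split=> //; exact/closed_openC/polygon_closed.
move=> /nbhs_ballP[e /= e0 ball_e]; exists e => // x y xe ye.
by apply: (ball_e (x, y)); split; rewrite /ball /= distrC.
Qed.

Lemma interior_near z e : P z -> 0 < e ->
  exists x y, [/\ P° (x, y), `|x - z.1| < e & `|y - z.2| < e].
Proof.
move=> + e0; rewrite -{1}(polygon_regular polyP) => /(_ (ball z e)) [|[x y] [Pxy]].
  exact: nbhsx_ballx.
by move=> [/= xe ye]; exists x, y; split; rewrite // distrC.
Qed.

Lemma interior_box z : P° z -> exists2 e, 0 < e &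
  forall x y, `|x - z.1| < e -> `|y - z.2| < e -> P (x, y).
Proof.
move=> /nbhs_ballP[e /= e0 ball_e]; exists e => // x y xe ye.
by apply: (ball_e (x, y)); split; rewrite /ball /= distrC.
Qed.

(** * The base line, blocking vertices and visibility intervals *)

Section BaseLine.
Variables xl xr y0 : R.
Hypothesis vertex_bounds : forall i, xl <= (v i).1 <= xr.
Hypothesis base_interior : forall x, xl < x < xr -> P° (x, y0).

Lemma polygon_edgeE i z : polygon_edge v i z =
  (seg (v i).1 (v (ordS i)).1 z.1 /\ seg (v i).2 (v (ordS i)).2 z.2).
Proof. by rewrite /polygon_edge /spanned_rect /= !segE. Qed.

(** By compactness, points far away on the same horizontal line are outside [P]; the line must leave
    [P] through an edge, and edges stay between [xl] and [xr]. *)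
Lemma polygon_bounds z : P z -> xl <= z.1 <= xr.
Proof.
move=> Pz.
have [M M_bound] : exists M, forall w, P w -> `|w.1| <= M.
  have [M [_ /(_ (M + 1))]] := compact_bounded (polygon_compact polyP).
  rewrite ltrDl ltr01 => /(_ isT) bM; exists (M + 1) => w /bM /=.
  by apply: le_trans; rewrite prod_normE le_max lexx.
have far x : M < `|x| -> ~ P (x, z.2).
  by move=> xM /M_bound /=; rewrite leNgt xM.
have edge_x i x y : polygon_edge v i (x, y) -> xl <= x <= xr.
  rewrite polygon_edgeE /seg /= => -[+ _].
  have := vertex_bounds i; have := vertex_bounds (ordS i); lra.
have M0 : `|z.1| <= M := M_bound z Pz.
have [leM geM] : - M <= z.1 /\ z.1 <= M by move: M0; rewrite ler_norml => /andP.
have Pz' : P (z.1, z.2) by case: (z) Pz.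
apply/andP; split.
  rewrite leNgt; apply/negP => z_lt.
  have [|i [x [sx /edge_x]]] := horizontal_exit Pz' (far (- M - 1) _).
    by rewrite -opprD normrN ger0_norm; lra.
  by move: sx; rewrite /seg; lra.
rewrite leNgt; apply/negP => z_lt.
have [|i [x [sx /edge_x]]] := horizontal_exit Pz' (far (M + 1) _).
  by rewrite ger0_norm; lra.
by move: sx; rewrite /seg; lra.
Qed.

Hypothesis base_in : forall x, xl <= x <= xr -> P (x, y0).

Definition closer (y yv : R) : bool := (y0 < y < yv) || (yv < y < y0).

(* A horizontal line slightly closer to the base line than [y] meets no vertex, so
   it can only leave [P] through a vertical edge, and that edge ends before the
   base line. *)
Lemma exit_vertex a x y : P (a, y) -> xl <= x <= xr -> ~ P (x, y) ->
  exists w, seg a x (v w).1 /\ closer (v w).2 y.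
Proof.
move=> Pa x_in Px.
have y_y0 : y != y0 by apply/eqP => yE; apply: Px; rewrite yE; exact: base_in.
have [e1 e1_0 out] := outside_box Px.
have [e2 e2_0 gap_y] := finite_gap (fun i => (v i).2) y.
have [e3 e3_0 gap_x] := finite_gap (fun i => (v i).1) a.
(* At ordinates closer than [d] to [y], the abscissa [x] is still outside [P], no vertex ordinate
   other than [y] occurs, and the base line is not reached. *)
have [d [d0 d1 d2 d3]] : exists d, [/\ 0 < d, d <= e1, d <= e2 & d <= `|y0 - y|].
  exists (Num.min e1 (Num.min e2 `|y0 - y|)).
  rewrite !lt_min e1_0 e2_0 normr_gt0 subr_eq0 eq_sym y_y0 !ge_min !lexx.
  by rewrite !orbT.
have [c cE] : exists c, (y0 < y /\ c = y - d / 2) \/ (y < y0 /\ c = y + d / 2).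
  case: (ltgtP y y0) y_y0 => // yy _; [exists (y + d / 2)|exists (y - d / 2)]; [by right|by left].
have d3' : (y0 < y /\ d <= y - y0) \/ (y < y0 /\ d <= y0 - y).
  case: (ltgtP y y0) y_y0 => // yy _; move: d3.
    by rewrite gtr0_norm ?subr_gt0 //; right.
  by rewrite ltr0_norm ?subr_lt0 // opprB; left.
have Pc : P (a, c).
  apply: vertical_convex Pa (base_in (polygon_bounds Pa)) _; rewrite /seg; lra.
(* Moving to an interior point by less than [d / 2] keeps the ordinate [c1] strictly between [y] and
   the base line. *)
have e_gt0 : 0 < Num.min e3 (d / 2) by rewrite lt_min e3_0; lra.
have [x1 [c1 [int1 x1_near c1_near]]] := interior_near Pc e_gt0.
move: x1_near c1_near; rewrite /= !lt_min !ltr_norml => /andP[x1_near _] /andP[_ c1_near].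
have c1_y : c1 != y by apply/eqP; lra.
have Px1 : ~ P (x, c1).
  by apply: out; rewrite /= ?subrr ?normr0 // ltr_norml; lra.
have [i [x' [sx' ix']]] := horizontal_exit (@interior_subset _ P _ int1) Px1.
have [Pix _] := edge_sub ix'.
have x'x : x' != x by apply/eqP => E; apply: Px1; rewrite -E.
have x1_in : xl < x1 < xr.
  have [e e0 box] := interior_box int1.
  have /polygon_bounds/= : P (x1 - e / 2, c1).
    by apply: box; rewrite /= ltr_norml; lra.
  have /polygon_bounds/= : P (x1 + e / 2, c1).
    by apply: box; rewrite /= ltr_norml; lra.
  lra.
have x'_in : xl < x' < xr by move: sx' x'x x1_in x_in; rewrite /seg; lra.
have no_base : ~ polygon_edge v i (x', y0).
  by move=> /edge_sub[_]; apply; exact: base_interior.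
move: ix' no_base; rewrite !polygon_edgeE /=.
(* A horizontal edge would have ordinate [c1], which differs from [y] by less than the gap [e2]. *)
have [xi|yi] := polygon_orthogonal polyP i; last first.
  move=> [_ yc]; have yE : (v i).2 = c1 by move: yc; rewrite -yi /seg; lra.
  have := gap_y i; rewrite yE c1_y => /(_ isT); rewrite leNgt.
  by rewrite ltr_norml; lra.
rewrite -xi => -[sx sy] no_base.
have xE : (v i).1 = x' by move: sx; rewrite /seg; lra.
(* The start [x1] may be on the wrong side of [a], but it is within [e3] of [a], where no other
   vertex abscissa lies. *)
have ax' : seg a x x'.
  have [<-|x'_a] := eqVneq x' a; first by rewrite /seg; lra.
  have := gap_x i; rewrite xE x'_a => /(_ isT); rewrite ler_normr.
  by move: sx' x1_near; rewrite /seg; lra.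
have no_base' : ~~ seg (v i).2 (v (ordS i)).2 y0.
  by apply/negP => sy0; apply: no_base; split; rewrite // xE /seg; lra.
(* The edge passes through ordinate [c1] without meeting the base line, so one of its endpoints is
   closer. *)
have [lo|lo] := boolP (closer (v i).2 y).
  by exists i; rewrite xE.
exists (ordS i); rewrite -xi xE; split=> //.
by move: sy no_base' lo; rewrite /seg /closer; lra.
Qed.

Definition horizontally_visible (u w : 'I_n) : Prop :=
  forall x, seg (v u).1 (v w).1 x -> P (x, (v u).2).

Definition above (w : 'I_n) : bool := y0 <= (v w).2.
Definition height (w : 'I_n) : R := `|(v w).2 - y0|.

Lemma closerP u w : closer (v w).2 (v u).2 -> above w = above u /\ height w < height u.
Proof.
rewrite /closer /above /height => /orP[] /andP[lt1 lt2].
  have lt3 := lt_trans lt1 lt2.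
  by rewrite !ltW // !gtr0_norm ?subr_gt0 //; split=> //; lra.
have lt3 := lt_trans lt1 lt2.
by rewrite (lt_geF lt2) (lt_geF lt3) !ltr0_norm ?subr_lt0 //; split=> //; lra.
Qed.

(** Among the vertices between [a] and [b] that are closer to the base line than [u], the one
    horizontally nearest to [a] works: an obstruction on the way to it would produce a nearer
    one. *)
Lemma horizontally_visible_exit u a b : horizontally_visible u a ->
  ~ horizontally_visible u b ->
  exists w, [/\ above w = above u, height w < height u, horizontally_visible u w &
    seg (v a).1 (v b).1 (v w).1].
Proof.
move=> ua /existsNP[x /not_implyP[ub_x Px]].
have Pa : P ((v a).1, (v u).2) by apply: ua; rewrite /seg; lra.
have bounds i := vertex_bounds i.
have ab_x : seg (v a).1 (v b).1 x.
  have : ~~ seg (v u).1 (v a).1 x by apply/negP => /ua.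
  by move: ub_x; rewrite /seg; lra.
pose W w := seg (v a).1 (v b).1 (v w).1 && closer (v w).2 (v u).2.
have x_in : xl <= x <= xr.
  by move: ab_x (bounds a) (bounds b); rewrite /seg; lra.
have [w0 [w0_x w0_y]] := exit_vertex Pa x_in Px.
have W0 : W w0.
  by rewrite /W w0_y andbT; move: ab_x w0_x; rewrite /seg; lra.
case: (@arg_minP _ _ _ w0 W (fun w => `|(v w).1 - (v a).1|) W0) => w /andP[abw wu] w_min.
have [aw hw] := closerP wu.
exists w; split=> // x' uw_x'; apply: contrapT => Px'.
have aw_x' : seg (v a).1 (v w).1 x'.
  have : ~~ seg (v u).1 (v a).1 x' by apply/negP => /ua.
  by move: uw_x'; rewrite /seg; lra.
have [e e0 out] := outside_box Px'.
(* Stopping strictly before [x'] makes the new vertex strictly nearer to [a], even if [x'] is the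
   abscissa of [w]. *)
have ax' : (v a).1 != x' by apply/eqP => E; apply: Px'; rewrite -E.
have [x2 [ax2 lt2 near2]] := pull_back ax' e0.
have Px2 : ~ P (x2, (v u).2) by apply: out; rewrite //= subrr normr0.
have x2_in : xl <= x2 <= xr.
  by move: ax2 aw_x' (bounds a) (bounds w); rewrite /seg; lra.
have [w2 [w2_x w2_y]] := exit_vertex Pa x2_in Px2.
have W2 : W w2.
  by rewrite /W w2_y andbT; move: w2_x ax2 aw_x' abw; rewrite /seg; lra.
have := w_min w2 W2; rewrite leNgt => /negP; apply.
apply: le_lt_trans (seg_dist w2_x) _; apply: lt_le_trans lt2 _.
exact: seg_dist.
Qed.

(** Beyond [a], the line of [w] is in [P], and the vertical segment from it to the base line crosses
    the line of [u]. *)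
Lemma horizontally_visible_nested u w a : above u = above w -> height u <= height w ->
  horizontally_visible u a -> horizontally_visible w a ->
  forall b, horizontally_visible w b -> horizontally_visible u b.
Proof.
move=> uw le_h ua wa b wb x ub_x.
have [/ua//|ua_x] := boolP (seg (v u).1 (v a).1 x).
have Pw : P (x, (v w).2).
  have [/wa//|wa_x] := boolP (seg (v w).1 (v a).1 x); apply: wb.
  by move: ub_x ua_x wa_x; rewrite /seg; lra.
apply: vertical_convex Pw (base_in (polygon_bounds Pw)) _.
move: uw le_h; rewrite /above /height /seg.
by case: (leP y0 (v u).2); case: (leP y0 (v w).2) => // ? ? _;
  [rewrite !ger0_norm ?subr_ge0 //|rewrite !ltr0_norm ?subr_lt0 //]; lra.
Qed.

(** The rectangle is filled by vertical segments between its horizontal sides, one side through each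
    vertex. *)
Lemma covisibleP u w : covisible P (v u) (v w) <->
  horizontally_visible u w /\ horizontally_visible w u.
Proof.
have refl (a b : R) : seg a b a by rewrite /seg; lra.
have segC (a b c : R) : seg a b c -> seg b a c by rewrite /seg; lra.
rewrite /covisible /spanned_rect; split=> [sub|[uw wu] [x y] /=].
  by split=> x sx; apply: sub; rewrite /= !segE; split=> //; exact: segC.
by rewrite !segE => -[sx sy]; apply: vertical_convex (uw _ sx) (wu _ (segC _ _ _ sx)) sy.
Qed.

End BaseLine.
End DoubleHistogram.

(** * From double histograms to interval systems *)

Lemma polygon_vertex_in (R : realType) (n : nat) (v : 'I_n -> R * R) (P : set (R * R)) u :
  orthogonal_polygon v P -> P (v u).
Proof.
move=> polyP; have [] // := edge_sub polyP (i := u) (z := v u) _.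
by rewrite polygon_edgeE /seg; lra.
Qed.

Lemma double_histogram_base (R : realType) (n : nat) (v : 'I_n -> R * R) (P : set (R * R)) :
  double_histogram v P -> exists xl xr y0 : R,
  [/\ forall i, xl <= (v i).1 <= xr,
      forall x, xl < x < xr -> P° (x, y0) &
      forall x, xl <= x <= xr -> P (x, y0)].
Proof.
case=> polyP _ _ [xl [xr [y [xl_xr [i [i_vert i_left] il] [j [j_vert j_right] jr] base]]]].
have ilE : (v i).1 = xl.
  by move: il; rewrite polygon_edgeE -i_vert /seg /= => -[+ _]; lra.
have jrE : (v j).1 = xr.
  by move: jr; rewrite polygon_edgeE -j_vert /seg /= => -[+ _]; lra.
exists xl, xr, y; split=> // [k|x /andP[]].
  by rewrite -ilE -jrE i_left j_right.
rewrite le_eqVlt => /predU1P[<- _|xl_x]; first by case: (edge_sub polyP il).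
rewrite le_eqVlt => /predU1P[->|x_xr]; first by case: (edge_sub polyP jr).
by apply: (@interior_subset _ P); apply: base; rewrite xl_x.
Qed.

Theorem theorem2 (R : realType) :
  exists (f : routing_function) (C : nat),
  forall (n : nat) (v : 'I_n -> (R * R)%type) (P : set (R * R)),
    double_histogram v P ->
    exists lab tab : 'I_n -> bitseq,
      [/\ correct_routing_scheme f (visibility_graph v P) lab tab,
          (forall i : 'I_n, (size (lab i) <= C * trunc_log 2 n)%N),
          (forall i : 'I_n, (size (tab i) <= C * trunc_log 2 n)%N) &
          forall (s t : 'I_n) (k : nat) (p : nat -> 'I_n) (h : nat -> bitseq),
            s <> t ->
            routing_path f (visibility_graph v P) lab tab s t k p h ->
            (forall i : nat, (i <= k)%N ->
               (size (h i) <= C * trunc_log 2 n)%N) /\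
            (k <= 2 * gdist (visibility_graph v P) s t)%N].
Proof.
(* Labels have [4 * (trunc_log 2 n).+1] bits, at most [8 * trunc_log 2 n] because [n] exceeds 2 and
   the logarithm is positive. *)
exists route, 8%N => n v P histP.
have [polyP _ monoP _] := histP.
have [xl [xr [y0 [bounds base_int base_in]]]] := double_histogram_base histP.
have n_gt2 := polygon_size polyP.
pose I u := [set w | `[< horizontally_visible v P u w >]]%SET.
have inI u w : (w \in I u) = `[< horizontally_visible v P u w >] by rewrite inE.
have graphE : visibility_graph v P = visible I.
  apply/funext => u; apply/funext => w; rewrite /visibility_graph /visible !inI.
  by congr (_ && _); rewrite -asbool_and; apply: asbool_equiv_eq; exact: covisibleP.
have [u|u a b c|u w a uw le_h|u a b|lab [correct lab_size stretch]] :=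
  @interval_system_routing _ _ (fun w => (v w).1) (height v y0) (above v y0) I
    (Ordinal (ltnW (ltnW n_gt2))).
- rewrite inI; apply/asboolP => x; rewrite /seg orbb => x_eq.
  have <- : (v u).1 = x by apply/eqP; rewrite eq_le.
  by rewrite -surjective_pairing; exact: (polygon_vertex_in u polyP).
- rewrite !inI /between segE => /asboolP ua /asboolP ub abc; apply/asboolP => x ux.
  have [/ua//|ua_x] := boolP (seg (v u).1 (v a).1 x).
  by apply: ub; move: ux ua_x abc; rewrite /seg; lra.
- rewrite !inI => /asboolP ua /asboolP wa; apply/fintype.subsetP => b; rewrite !inI.
  move=> /asboolP wb; apply/asboolP.
  exact: (horizontally_visible_nested polyP monoP bounds base_in uw le_h ua wa wb).
- rewrite !inI => /asboolP ua /asboolP ub.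
  have [w [w_above w_lt uw abw]] :=
    horizontally_visible_exit polyP monoP bounds base_int base_in ua ub.
  by exists w; rewrite /between segE inI; split=> //; exact/asboolP.
have log_gt0 : (0 < trunc_log 2 n)%N.
  by apply: trunc_log_max => //; exact: ltnW.
exists lab, lab; rewrite graphE; split=> // [i|i|s t k p h _ /stretch[h_nil k_le]].
- by rewrite lab_size card_ord; lia.
- by rewrite lab_size card_ord; lia.
by split=> // i /h_nil ->.
Qed.
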